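(* Let $k\ge 2$, let $\sigma\in\{+,-\}^k$, let $n\ge 1$ and let $\pi=\pi_1\cdots\pi_n\in\mathfrak S_n$. Then $\pi\in\mathcal A_n(\Sigma_\sigma)$ if and only if both of the following hold: (i) $\hat\pi^*\in\mathcal C^{\sigma,*}$, i.e. $\hat\pi^*$ admits a $*$-$\sigma$-segmentation; (ii) (condition $(\dagger)$) there exists a $*$-$\sigma$-segmentation $0=e_0\le e_1\le\cdots\le e_k=n$ of $\hat\pi^*$ such that there is no integer $b\ge 1$ with $n-2b\ge 1$ satisfying both • $\rho(\pi_{n-2b},\pi_{n-b},\pi_n)\in\{312,\,132\}$, and • for every $1\le i\le b$ and every $0\le t\le k-1$: $e_t<\pi_{n-b-i}\le e_{t+1}$ if and only if $e_t<\pi_{n-i}\le e_{t+1}$.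
   Context: Fix $k\ge2$ and a signature $\sigma=\sigma_0\sigma_1\cdots\sigma_{k-1}\in\{+,-\}^k$; let $T^+_\sigma=\{t:\sigma_t=+\}$ and $T^-_\sigma=\{t:\sigma_t=-\}$. Let $\mathcal W_k$ be the set of infinite words $s=s_1s_2\cdots$ over the alphabet $\{0,1,\dots,k-1\}$. The linear order $\prec_\sigma$ on $\mathcal W_k$ is defined as follows: for $s\neq t$, let $j$ be the smallest index with $s_j\ne t_j$ and $c=|\{1\le i<j: s_i\in T^-_\sigma\}|$; then $s\prec_\sigma t$ iff either $c$ is even and $s_j<t_j$, or $c$ is odd and $s_j>t_j$. The signed shift is $\Sigma_\sigma:\mathcal W_k\to\mathcal W_k$, $\Sigma_\sigma(s_1s_2s_3\cdots)=s_2s_3\cdots$. For distinct elements $x_1,\dots,x_n$ of a linearly ordered set, $\rho(x_1,\dots,x_n)$ is the permutation of $[n]$ (in one-line notation) whose entries are in the same relative order as $x_1,\dots,x_n$. For $s\in\mathcal W_k$, if $s,\Sigma_\sigma(s),\dots,\Sigma_\sigma^{n-1}(s)$ are pairwise distinct, $\mathrm{Pat}(s,\Sigma_\sigma,n)=\rho(s,\Sigma_\sigma(s),\dots,\Sigma_\sigma^{n-1}(s))$ with respect to $\prec_\sigma$; otherwise it is undefined. $\mathcal A_n(\Sigma_\sigma)$ is the set of all defined $\mathrm{Pat}(s,\Sigma_\sigma,n)$, $s\in\mathcal W_k$. For $\pi=\pi_1\cdots\pi_n\in\mathfrak S_n$, $\hat\pi$ is the cyclic permutation with cycle notation $(\pi_1,\pi_2,\dots,\pi_n)$,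 i.e. $\hat\pi_{\pi_i}=\pi_{i+1}$ with $\pi_{n+1}:=\pi_1$; $\hat\pi^*$ is the word obtained from the one-line notation $\hat\pi_1\cdots\hat\pi_n$ by replacing the entry equal to $\pi_1$ (located at position $\pi_n$) by the symbol $*$. A $*$-permutation of length $n$ is a word $\tau^*=\tau^*_1\cdots\tau^*_n$ obtained from a permutation of $[n]$ by replacing one entry by $*$; $\mathcal C_n^*$ is the set of $*$-permutations for which the permutation obtained by restoring the missing value is an $n$-cycle. A $*$-$\sigma$-segmentation of $\tau^*$ is a sequence $0=e_0\le e_1\le\cdots\le e_k=n$ such that: (a) for each $0\le t\le k-1$, the entries of $\tau^*_{e_t+1}\cdots\tau^*_{e_{t+1}}$ other than $*$ are increasing if $\sigma_t=+$ and decreasing if $\sigma_t=-$; (b) if $\sigma_0=+$ and $\tau^*_1\tau^*_2=*1$, then $e_1\le1$; (c) if $\sigma_{k-1}=+$ and $\tau^*_{n-1}\tau^*_n=n*$, then $e_{k-1}\ge n-1$; (d) if $\sigma_0=\sigma_{k-1}=-$, $\tau^*_1=n$ and $\tau^*_{n-1}\tau^*_n=1*$, then $e_1=0$ or $e_{k-1}\ge n-1$; (e) if $\sigma_0=\sigma_{k-1}=-$, $\tau^*_n=1$ and $\tau^*_1\tau^*_2=*n$, then $e_{k-1}=n$ or $e_1\le1$. $\mathcal C^{\sigma,*}$ is the set of $\tau^*\in\bigcup_n\mathcal C_n^*$ that admit a $*$-$\sigma$-segmentation. *)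

(* Defs.v *)
From mathcomp Require Import all_boot all_fingroup.

Set Implicit Arguments.
Unset Strict Implicit.
Unset Printing Implicit Defensive.

(* The paper indexes letters of words and entries of permutations from 1.
   Infinite words s_1 s_2 ... are functions on nat with s_(i+1) = s i.
   Finite words are sequences, read from position 1 by [entry]. *)

Definition entry (w : seq nat) (i : nat) : nat := nth 0 w i.-1.

(* One-line notation, with values in {1, ..., n}. *)
Definition one_line (n : nat) (p : 'S_n) : seq nat :=
  [seq (p i).+1 | i <- enum 'I_n].

(* [is_rho lt x w] means that rho(x_1, ..., x_n) = w, for lt a strict order
   and w a permutation of [n] in one-line notation. *)
Definition is_rho (T : Type) (lt : T -> T -> Prop) (n : nat)
    (x : n.-tuple T) (w : seq nat) : Prop :=
  perm_eq w (iota 1 n) /\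
  forall i j : 'I_n,
    lt (tnth x i) (tnth x j) <-> nth 0 w i < nth 0 w j.

(* In a signature, true stands for + and false for -. *)
Definition signature (k : nat) : predArgType := k.-tuple bool.

Definition word (k : nat) : Type := nat -> 'I_k.

Definition minus_count (k : nat) (sigma : signature k) (s : word k) (j : nat)
    : nat :=
  \sum_(i < j) ~~ tnth sigma (s i).

Definition prec (k : nat) (sigma : signature k) (s t : word k) : Prop :=
  exists j : nat,
    [/\ forall i : nat, i < j -> s i = t i,
        s j <> t j
      & if odd (minus_count sigma s j) then s j > t j else s j < t j].

Definition shift (k : nat) (s : word k) : word k := fun i => s i.+1.

(* Pat(s, Sigma_sigma, n) is defined and equal to pi. *)
Definition is_Pat (k : nat) (sigma : signature k) (n : nat) (s : word k)
    (pi : 'S_n) : Prop :=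
  (forall i j : 'I_n, i != j -> ~ iter i (@shift k) s =1 iter j (@shift k) s)
  /\ is_rho (prec sigma) [tuple iter i (@shift k) s | i < n] (one_line pi).

(* pi belongs to A_n(Sigma_sigma). *)
Definition allowed (k : nat) (sigma : signature k) (n : nat) (pi : 'S_n)
    : Prop :=
  exists s : word k, is_Pat sigma s pi.

Lemma hat_subproof (n : nat) (pi : 'S_n) :
  injective (fun x : 'I_n => pi (ordS ((pi^-1)%g x))).
Proof. by move=> x y /perm_inj /ordS_inj /perm_inj. Qed.

(* The cycle (pi_1, ..., pi_n); ordS is the cyclic successor on 'I_n. *)
Definition hat (n : nat) (pi : 'S_n) : 'S_n := perm (@hat_subproof n pi).

(* In words with a star, None is the star. *)
Definition star (v : nat) (w : seq nat) : seq (option nat) :=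
  [seq if x == v then None else Some x | x <- w].

Definition hat_star (n : nat) (pi : 'S_n) : seq (option nat) :=
  star (entry (one_line pi) 1) (one_line (hat pi)).

Definition is_full_cycle (n : nat) (p : 'S_n) : Prop :=
  porbits p = [set [set: 'I_n]].

Definition in_C_star (n : nat) (tau : seq (option nat)) : Prop :=
  exists (p : 'S_n) (v : nat),
    [/\ is_full_cycle p, v \in one_line p & tau = star v (one_line p)].

(* The factor tau_(a+1) ... tau_b with its star, if any, removed. *)
Definition block (tau : seq (option nat)) (a b : nat) : seq nat :=
  pmap id (take (b - a) (drop a tau)).

Definition starts_with (tau u : seq (option nat)) : Prop :=
  take (size u) tau = u.

Definition ends_with (tau u : seq (option nat)) : Prop :=
  size u <= size tau /\ drop (size tau - size u) tau = u.

Record segmentation (k : nat) (sigma : signature k) (tau : seq (option nat))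
    (e : seq nat) : Prop := Segmentation {
  seg_size : size e = k.+1;
  seg_first : nth 0 e 0 = 0;
  seg_last : nth 0 e k = size tau;
  seg_sorted : sorted leq e;
  seg_a : forall t : 'I_k,
    sorted (if tnth sigma t then ltn else gtn)
           (block tau (nth 0 e t) (nth 0 e t.+1));
  seg_b : nth true sigma 0 = true ->
    starts_with tau [:: None; Some 1] ->
    nth 0 e 1 <= 1;
  seg_c : nth true sigma k.-1 = true ->
    ends_with tau [:: Some (size tau); None] ->
    nth 0 e k.-1 >= size tau - 1;
  seg_d : nth true sigma 0 = false -> nth true sigma k.-1 = false ->
    starts_with tau [:: Some (size tau)] ->
    ends_with tau [:: Some 1; None] ->
    nth 0 e 1 = 0 \/ nth 0 e k.-1 >= size tau - 1;
  seg_e : nth true sigma 0 = false -> nth true sigma k.-1 = false ->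
    ends_with tau [:: Some 1] ->
    starts_with tau [:: None; Some (size tau)] ->
    nth 0 e k.-1 = size tau \/ nth 0 e 1 <= 1
}.

Definition in_C_sigma_star (k : nat) (sigma : signature k)
    (tau : seq (option nat)) : Prop :=
  (exists n : nat, in_C_star n tau) /\
  exists e : seq nat, segmentation sigma tau e.

(* The integers b excluded by condition (dagger) for a segmentation e. *)
Definition dagger_obstruction (k n : nat) (pi : 'S_n) (e : seq nat) (b : nat)
    : Prop :=
  let p := entry (one_line pi) in
  let x := [tuple p (n - 2 * b); p (n - b); p n] in
  [/\ b >= 1,
      n - 2 * b >= 1,
      is_rho (fun u v : nat => u < v) x [:: 3; 1; 2] \/
      is_rho (fun u v : nat => u < v) x [:: 1; 3; 2]
    & forall i t : nat, 1 <= i <= b -> t < k ->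
        (nth 0 e t < p (n - b - i) <= nth 0 e t.+1) <->
        (nth 0 e t < p (n - i) <= nth 0 e t.+1)].

Definition dagger (k : nat) (sigma : signature k) (n : nat) (pi : 'S_n)
    : Prop :=
  exists e : seq nat,
    segmentation sigma (hat_star pi) e /\
    ~ exists b : nat, dagger_obstruction k pi e b.

(* Main.v *)
Require Import Defs.
From mathcomp Require Import all_boot all_fingroup.
From mathcomp Require Import zify.
From Stdlib Require Import Classical_Prop.

Set Implicit Arguments.
Unset Strict Implicit.
Unset Printing Implicit Defensive.

(* Write [u_i = z_i ... z_(n-1)] for the itinerary of [pi_i, ..., pi_(n-1)]
   through the blocks of a segmentation. A word [z_1 ... z_(n-1) w] has pattern
   [pi] as soon as each [u_i w] lies on the same side of [w] as [pi_i] does of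
   [pi_n]. For every finite word [u], the words [u w] and [u^oo] lie on the same
   side of [w], so [w] must separate the powers [u_i^oo] with [pi_i < pi_n] from
   those with [pi_i > pi_n]. Extending the cycle weakly monotonically at the
   star yields a word [w0], the itinerary of [pi_n], that separates them weakly.
   If [w0 = u_i^oo], condition (dagger) keeps all powers equal to [w0] on one
   side, since they have a common root, and [w0] is moved off them by changing a
   far tail; conditions (b)-(e) say that [w0] is not an extreme word, so that
   there is room for this. Conversely, the blocks of a segmentation are read off
   the first letters of a realizing word and its shifts. *)

Definition sltn (d : bool) (a b : nat) : bool := if d then b < a else a < b.

Section SignedNaturals.

Implicit Types (d : bool) (a b c : nat).

Lemma sltnn d a : sltn d a a = false.
Proof. by case: d; rewrite /sltn ltnn. Qed.

Lemma sltnC d a b : sltn (~~ d) a b = sltn d b a.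
Proof. by case: d. Qed.

Lemma sltnNC d a b : a != b -> ~~ sltn d a b = sltn d b a.
Proof. by case: d; rewrite /sltn; lia. Qed.

Lemma sltn_trans d b a c : sltn d a b -> sltn d b c -> sltn d a c.
Proof. by case: d; rewrite /sltn; lia. Qed.

Lemma sltn_asym d a b : sltn d a b -> ~~ sltn d b a.
Proof. by case: d; rewrite /sltn; lia. Qed.

Lemma sltn_total a b : a != b -> exists d, sltn d a b.
Proof. by move=> ne; exists (b < a); rewrite /sltn; case: ltnP; lia. Qed.

Lemma sltn_dir d e a b : sltn d a b -> sltn e a b -> d = e.
Proof. by case: d; case: e; rewrite /sltn; lia. Qed.

(* If the shift preserves the order of the sequence, the sequence is monotone;
   if it reverses it, every later term lies between [a 1] and [a 2]. *)
Lemma sltn_shift_equivariant (a : nat -> nat) (q : nat) (flip d : bool) :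
  (forall e i j, i < q -> j < q -> sltn e (a i) (a j) ->
     sltn (e (+) flip) (a i.+1) (a j.+1)) ->
  sltn d (a 1) (a 0) -> (1 < q -> sltn d (a 2) (a 0)) ->
  forall j, 0 < j <= q -> sltn d (a j) (a 0).
Proof.
move=> shift_a lt1 lt2 j jq.
suff [] : sltn d (a j) (a 0) /\ (flip -> j = 1 \/ sltn d (a 1) (a j)) by [].
elim: j jq => // -[_ _|j IHj jq]; first by split=> //; left.
have [ltj ge1] := IHj ltac:(lia).
move: shift_a ge1 (shift_a _ j.+1 0 ltac:(lia) ltac:(lia) ltj).
case: (flip) => shift_a ge1; rewrite ?addbF ?addbT ?sltnC => ltj1.
  split; last by right.
  case: (ge1 isT) => [[->]|lt1j]; first by apply: lt2; lia.
  have := shift_a _ 1 j.+1 ltac:(lia) ltac:(lia) lt1j.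
  by rewrite addbT sltnC => /sltn_trans; apply; apply: lt2; lia.
by split=> //; apply: sltn_trans ltj1 lt1.
Qed.

End SignedNaturals.

Section SignedOrder.

Variables (k : nat) (sigma : signature k).
Implicit Types (s t u w : word k) (d : bool) (i j l m : nat).

Definition neg (a : 'I_k) : bool := ~~ tnth sigma a.

Definition agree l s t : Prop := forall i, i < l -> s i = t i.

Lemma agree_sym l s t : agree l s t -> agree l t s.
Proof. by move=> st i /st. Qed.

Lemma agree_leq m l s t : l <= m -> agree m s t -> agree l s t.
Proof. by move=> lm st i il; apply: st; apply: leq_trans lm. Qed.

Lemma agree_eq1 l s t : s =1 t -> agree l s t.
Proof. by move=> st i _. Qed.

Definition wdrop l s : word k := fun m => s (l + m).

Lemma iter_shift l s : iter l (@shift k) s =1 wdrop l s.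
Proof.
by elim: l s => [|l IHl] s m //; rewrite iterSr IHl /wdrop /shift addSn.
Qed.

Definition parity s l : bool := odd (minus_count sigma s l).

Lemma parity0 s : parity s 0 = false.
Proof. by rewrite /parity /minus_count big_ord0. Qed.

Lemma parityS s l : parity s l.+1 = parity s l (+) neg (s l).
Proof. by rewrite /parity /minus_count big_ord_recr /= oddD oddb. Qed.

Lemma agree_parity l s t : agree l s t -> parity s l = parity t l.
Proof.
move=> st; rewrite /parity /minus_count; congr (odd _).
by apply: eq_bigr => i _; rewrite st.
Qed.

Lemma parityD s l m : parity s (l + m) = parity s l (+) parity (wdrop l s) m.
Proof.
elim: m => [|m IHm]; first by rewrite addn0 parity0 addbF.
by rewrite addnS !parityS IHm addbA.
Qed.

Definition wlt_at d j s t : Prop :=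
  agree j s t /\ sltn (d (+) parity s j) (s j) (t j).

(* [wlt false] is the order [prec] and [wlt true] its converse. *)
Definition wlt d s t : Prop := exists j, wlt_at d j s t.

Lemma precE s t : prec sigma s t <-> wlt false s t.
Proof.
split=> [[j [st _ lt]]|[j [st lt]]]; exists j.
  by split=> //; rewrite /sltn /parity addFb; case: odd lt.
by split=> // eqj; rewrite eqj sltnn in lt.
Qed.

Lemma wltC d s t : wlt (~~ d) s t <-> wlt d t s.
Proof.
suff imp e x y : wlt (~~ e) x y -> wlt e y x.
  by split; [exact: imp|rewrite -{1}[d]negbK; exact: imp].
case=> j [xy lt]; exists j; split; first exact: agree_sym.
by rewrite -(agree_parity xy) -sltnC -addNb.
Qed.

Lemma agree_wlt_at d j s s' t t' :
  agree j.+1 s s' -> agree j.+1 t t' -> wlt_at d j s t -> wlt_at d j s' t'.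
Proof.
move=> ss tt [st lt]; split=> [i ij|].
  by rewrite -ss ?leqW // -tt ?leqW // st.
by rewrite -(agree_parity (agree_leq (leqnSn j) ss)) -ss // -tt.
Qed.

Lemma eq_wlt d s s' t t' : s =1 s' -> t =1 t' -> wlt d s t -> wlt d s' t'.
Proof.
by move=> ss tt [j st]; exists j; apply: agree_wlt_at st; apply: agree_eq1.
Qed.

Lemma eq_wltl d s s' t : s =1 s' -> wlt d s t -> wlt d s' t.
Proof. by move=> ss; apply: eq_wlt. Qed.

Lemma eq_wltr d s t t' : t =1 t' -> wlt d s t -> wlt d s t'.
Proof. by move=> tt; apply: eq_wlt. Qed.

Lemma wlt_neq d s t : wlt d s t -> ~ s =1 t.
Proof. by case=> j [_ lt] st; rewrite st sltnn in lt. Qed.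

Lemma wlt_trans d t s u : wlt d s t -> wlt d t u -> wlt d s u.
Proof.
case=> i [st lti] [j [tu ltj]].
case: (ltngtP i j) => [ij|ji|eij].
- exists i; split=> [m mi|]; last by rewrite -tu.
  by rewrite st // tu // (ltn_trans mi).
- have st_j := agree_leq (ltnW ji) st; exists j; split=> [m mj|].
    by rewrite st_j ?tu.
  by rewrite (agree_parity st_j) st.
- subst j; exists i; split=> [m mi|]; first by rewrite st ?tu.
  by apply: sltn_trans lti _; rewrite (agree_parity st).
Qed.

Lemma wlt_asym d s t : wlt d s t -> ~ wlt d t s.
Proof. by move=> st ts; apply: (wlt_neq (wlt_trans st ts)). Qed.

Lemma wlt_total d s t : ~ s =1 t -> wlt d s t \/ wlt d t s.
Proof.
move=> ne; have /ex_minnP[j nej min_j] : exists j, s j != t j.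
  apply: NNPP => none; apply: ne => j; apply/eqP/negPn/negP => nej.
  by apply: none; exists j.
have st : agree j s t.
  by move=> i ij; apply/eqP; apply: contraTT ij => /min_j; rewrite -leqNgt.
case: (boolP (sltn (d (+) parity s j) (s j) (t j))) => [lt|].
  by left; exists j.
rewrite sltnNC // => gt; right; exists j; split; first exact: agree_sym.
by rewrite -(agree_parity st).
Qed.

Lemma wlt_head d s t : sltn d (s 0) (t 0) -> wlt d s t.
Proof. by move=> lt; exists 0; split=> //; rewrite parity0 addbF. Qed.

Lemma wlt_at_shift d j s t : s 0 = t 0 ->
  wlt_at d j.+1 s t <-> wlt_at (d (+) neg (s 0)) j (shift s) (shift t).
Proof.
have parity_shift : parity s j.+1 = neg (s 0) (+) parity (shift s) j.
  by rewrite -add1n parityD parityS parity0.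
rewrite /wlt_at parity_shift addbA => st0.
split=> -[st lt]; split=> //; first by move=> i ij; apply: (st i.+1).
by case=> [|i] // ij; apply: (st i).
Qed.

Lemma wlt_shift d s t : s 0 = t 0 ->
  wlt d s t <-> wlt (d (+) neg (s 0)) (shift s) (shift t).
Proof.
move=> st0; split=> [[[|j] lt]|[j lt]].
- by case: lt; rewrite st0 sltnn.
- by exists j; apply/wlt_at_shift.
- by exists j.+1; apply/wlt_at_shift.
Qed.

Definition wcat l u w : word k := fun m => if m < l then u m else w (m - l).

Lemma agree_wcat l u w : agree l (wcat l u w) u.
Proof. by move=> m ml; rewrite /wcat ml. Qed.

Lemma wdrop_wcat l u w : wdrop l (wcat l u w) =1 w.
Proof. by move=> m; rewrite /wdrop /wcat ltnNge leq_addr addKn. Qed.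

Lemma wcat_wdrop l s : wcat l s (wdrop l s) =1 s.
Proof. by move=> m; rewrite /wcat /wdrop; case: ltnP => // /subnKC->. Qed.

Lemma wlt_wcat2l d l u s t :
  wlt d s t -> wlt (d (+) parity u l) (wcat l u s) (wcat l u t).
Proof.
case=> j [st lt]; exists (l + j); split=> [i ij|].
  by rewrite /wcat; case: ltnP => // li; apply: st; lia.
have catE w : wcat l u w (l + j) = w j := wdrop_wcat l u w j.
rewrite parityD (agree_parity (@agree_wcat l u s)) !catE.
rewrite (@agree_parity j _ s); first by rewrite addbA addbK.
by move=> i _; apply: wdrop_wcat.
Qed.

Definition wpower l u : word k := fun m => u (m %% l).

Lemma agree_wpower l u : agree l (wpower l u) u.
Proof. by move=> m ml; rewrite /wpower modn_small. Qed.

Lemma wpower_square l u : 0 < l ->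
  agree l u (wdrop l u) -> wpower (2 * l) u =1 wpower l (wdrop l u).
Proof.
move=> l_gt0 sq m; rewrite /wpower -(modn_dvdm m (dvdn_mull 2 (dvdnn l))).
have : m %% (2 * l) < 2 * l by rewrite ltn_mod muln_gt0.
move: (m %% (2 * l)) => r r_lt; case: (ltnP r l) => [rl|lr].
  by rewrite modn_small // sq.
have -> : r %% l = r - l by rewrite -{1}(subnK lr) modnDr modn_small //; lia.
by rewrite /wdrop subnKC.
Qed.

(* Up to and including the first place where either of them differs from [w],
   the words [u w] and [u^oo] coincide. *)
Lemma wlt_wcat_wpower d l u w : 0 < l ->
  wlt d (wcat l u w) w <-> wlt d (wpower l u) w.
Proof.
move=> l_gt0.
have catE m : l <= m -> wcat l u w m = w (m - l) by rewrite /wcat; case: ltnP.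
have powE m : l <= m -> wpower l u m = wpower l u (m - l).
  by move=> lm; rewrite /wpower -{1}(subnK lm) modnDr.
have cat_pow j : agree j (wcat l u w) w -> agree j.+1 (wcat l u w) (wpower l u).
  move=> cw m; elim/ltn_ind: m => m IHm mj; case: (ltnP m l) => ml.
    by rewrite agree_wcat ?agree_wpower.
  by rewrite catE // powE // -IHm ?cw //; lia.
have pow_cat j : agree j (wpower l u) w -> agree j.+1 (wpower l u) (wcat l u w).
  move=> pw m mj; case: (ltnP m l) => ml.
    by rewrite agree_wcat ?agree_wpower.
  by rewrite catE // powE // pw //; lia.
split=> -[j [eqj lt]]; exists j.
  by apply: (agree_wlt_at (cat_pow j eqj) _ (conj eqj lt)).
by apply: (agree_wlt_at (pow_cat j eqj) _ (conj eqj lt)).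
Qed.

Lemma wlt_wcat_wpower_r d l u w : 0 < l ->
  wlt d w (wcat l u w) <-> wlt d w (wpower l u).
Proof. by move=> l_gt0; rewrite -2!(wltC d) wlt_wcat_wpower. Qed.

Definition periodic l s : Prop := wdrop l s =1 s.

Lemma wpower_periodic l u : periodic l (wpower l u).
Proof. by move=> m; rewrite /wdrop /wpower modnDl. Qed.

Lemma periodicM q l s : periodic l s -> periodic (q * l) s.
Proof.
move=> s_l; elim: q => [|q IHq] m //.
by rewrite /wdrop mulSn -addnA [LHS]s_l; apply: IHq.
Qed.

Lemma eq_periodic l s t : s =1 t -> periodic l s -> periodic l t.
Proof. by move=> st s_l m; rewrite /wdrop -!st; apply: s_l. Qed.

Lemma periodic_gcd l m s :
  0 < l -> periodic l s -> periodic m s -> periodic (gcdn l m) s.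
Proof.
move=> l_gt0 s_l s_m i; have [a _ /dvdnP[c gcdE]] := Bezoutl m l_gt0.
rewrite /wdrop -[LHS](periodicM a s_m) /wdrop addnA [a * m + _]addnC gcdE.
exact: (periodicM c s_l).
Qed.

(* Twice a period has even parity, so replacing the tail of [w] after an even
   number of periods by [b] yields words above [w] arbitrarily close to it. *)
Lemma periodic_dense d l w b (I : finType) (x : I -> word k) :
  0 < l -> periodic l w -> wlt d w b -> (forall a, wlt d w (x a)) ->
  exists2 w', wlt d w w' & forall a, wlt d w' (x a).
Proof.
move=> l_gt0 w_l lt_b /fin_all_exists[m lt_x].
pose h := l * (\max_a m a).+1.
have w_h : periodic h w by rewrite /h mulnC; apply: periodicM.
have parity2 : parity w (h + h) = false.
  by rewrite parityD (agree_parity (agree_eq1 w_h)) addbb.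
exists (wcat (h + h) w b) => [|a].
  have := wlt_wcat2l (h + h) w lt_b; rewrite parity2 addbF; apply: eq_wltl.
  move=> j; rewrite /wcat; case: ltnP => // hj.
  by rewrite -[RHS](congr1 w (subnKC hj)) -addnA [RHS]w_h [RHS]w_h.
exists (m a); apply: (agree_wlt_at _ (agree_eq1 (frefl _)) (lt_x a)).
apply: (@agree_leq (h + h)); last exact/agree_sym/agree_wcat.
by have := @leq_bigmax _ m a; rewrite /h; nia.
Qed.

End SignedOrder.

Section ExtremeWords.

Variables (k : nat) (sigma : signature k.+1).
Implicit Types (d : bool) (s w : word k.+1).

Definition extreme_letter d : 'I_k.+1 := if d then ord_max else ord0.

Local Notation letter_neg d := (neg sigma (extreme_letter d)).

Lemma extreme_letterP d (a : 'I_k.+1) : ~~ sltn d a (extreme_letter d).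
Proof. by case: d; rewrite /sltn //= -leqNgt leq_ord. Qed.

Lemma extreme_letter_neq d : 0 < k -> extreme_letter d != extreme_letter (~~ d).
Proof. by case: d; rewrite -val_eqE /=; lia. Qed.

(* The least word if [d = false], the greatest if [d = true]. *)
Fixpoint extreme_word d (j : nat) : 'I_k.+1 :=
  if j is i.+1 then extreme_word (d (+) letter_neg d) i else extreme_letter d.

Lemma extreme_wordP d s : ~ wlt sigma d s (extreme_word d).
Proof.
case=> j; elim: j d s => [|j IHj] d s lt_s.
  by case: lt_s => _; rewrite parity0 addbF; apply/negP/extreme_letterP.
have s0 : s 0 = extreme_word d 0 by case: lt_s => /(_ 0 erefl).
by move/(wlt_at_shift sigma d j s0): lt_s; rewrite s0; apply: IHj.
Qed.

Lemma extreme_word_wlt d w :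
  ~ extreme_word d =1 w -> wlt sigma d (extreme_word d) w.
Proof. by move=> ne; case: (wlt_total sigma d ne) => // /extreme_wordP. Qed.

Lemma extreme_word_const d j :
  ~~ letter_neg d -> extreme_word d j = extreme_letter d.
Proof. by move=> pos; elim: j => //= j; rewrite (negbTE pos) addbF. Qed.

Lemma extreme_word_alternating d j : letter_neg d -> letter_neg (~~ d) ->
  extreme_word d j = extreme_letter (d (+) odd j).
Proof.
elim: j d => [|j IHj] d neg_d neg_nd /=; first by rewrite addbF.
by rewrite neg_d addbT IHj ?negbK // addNb addbN.
Qed.

Lemma extreme_word_recurrent d l :
  0 < k -> 0 < l -> extreme_word d l = extreme_letter d ->
  ~~ letter_neg d \/ [/\ letter_neg d, letter_neg (~~ d) & ~~ odd l].
Proof.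
move=> k_gt0; case: l => // l _ ext_l; have ne := extreme_letter_neq d k_gt0.
have [neg_d|] := boolP (letter_neg d); [right|by left].
have neg_nd : letter_neg (~~ d).
  apply: contraNT ne => pos; rewrite -{1}ext_l /= neg_d addbT.
  by rewrite extreme_word_const.
split=> //; apply: contra ne => odd_l; rewrite -{1}ext_l.
by rewrite extreme_word_alternating // odd_l addbT.
Qed.

Lemma not_wlt_wcat_extreme d l u w :
  0 < l -> wpower l u =1 extreme_word d -> ~ wlt sigma d w (wcat l u w).
Proof.
move=> l_gt0 ext /(wlt_wcat_wpower_r _ _ _ _ l_gt0) lt.
by apply: (@extreme_wordP d w); apply: eq_wltr lt.
Qed.

End ExtremeWords.

Section Values.

Variables (n : nat) (pi : 'S_n.+1).
Implicit Types (d : bool) (i j v : nat).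

(* Positions and values are counted from 0, so [value (n - b)] is
   [pi_(n.+1 - b) - 1] in the notation of the statement. *)
Definition value i : nat := pi (inord i).

Lemma value_le i : value i <= n.
Proof. exact: leq_ord. Qed.

Lemma value_eq i j : i <= n -> j <= n -> (value i == value j) = (i == j).
Proof.
move=> i_n j_n; rewrite /value (inj_eq val_inj) (inj_eq perm_inj) -val_eqE /=.
by rewrite !inordK.
Qed.

Lemma value_surj v : v <= n -> exists2 i, i <= n & value i = v.
Proof.
move=> vn; exists ((pi^-1)%g (inord v)); first exact: leq_ord.
by rewrite /value inord_val permKV inordK.
Qed.

Lemma value_neq_last i : i < n -> value i != value n.
Proof. by move=> i_n; rewrite value_eq ?(ltnW i_n) ?ltn_eqF. Qed.

Lemma value_surj_last v :
  v <= n -> v != value n -> exists2 i, i < n & value i = v.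
Proof.
move=> vn; have [i i_n <-] := value_surj vn; rewrite value_eq // => ne.
by exists i; rewrite // ltn_neqAle ne.
Qed.

Lemma valueK i : i <= n -> (pi^-1)%g (inord (value i)) = i :> nat.
Proof. by move=> i_n; rewrite /value inord_val permK inordK. Qed.

Lemma value_side i : i < n -> exists d, sltn d (value i) (value n).
Proof. by move=> i_n; apply/sltn_total/value_neq_last. Qed.

(* Counting from below or from above, depending on [d], turns (c) into (b) and
   (d) into (e). *)
Definition edge d i := if d then n - i else i.

Lemma edge_le d i : i <= n -> edge d i <= n.
Proof. by case: d => //= _; apply: leq_subr. Qed.

Lemma value_edge_slt d i :
  i < n -> value n = edge d 0 -> sltn d (value n) (value i).
Proof.
move=> i_n last_n; have := value_neq_last i_n; have := value_le i.
by rewrite last_n /sltn /edge; case: (d) => /=; lia.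
Qed.

End Values.

Section Realization.

Variables (k : nat) (sigma : signature k.+1) (n : nat) (pi : 'S_n.+1).

Local Notation p := (value pi).
Local Notation edge := (edge n).
Local Notation letter := (extreme_letter k).
Local Notation neg := (neg sigma).
Local Notation wlt := (wlt sigma).
Local Notation parity := (parity sigma).
Implicit Types (d : bool) (s w : word k.+1) (label : nat -> 'I_k.+1).

(* Conditions (a)-(e) of a segmentation, in terms of the map [label] sending a
   value to the index of its block. *)
Record compatible label : Prop := Compatible {
  label_mono : forall u v, u <= v -> v <= n -> label u <= label v;
  next_mono : forall d i j, i < n -> j < n -> label (p i) = label (p j) ->
    sltn d (p i) (p j) -> sltn (d (+) neg (label (p i))) (p i.+1) (p j.+1);
  edge_not_fixed : forall d, 0 < n -> ~~ neg (letter d) ->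
    p n = edge d 0 -> p n.-1 = edge d 1 -> label (edge d 1) != letter d;
  edge_not_swapped : forall d, 1 < n -> neg (letter d) -> neg (letter (~~ d)) ->
    p n = edge d 0 -> p n.-1 = edge (~~ d) 0 -> p n.-2 = edge d 1 ->
    (label (edge (~~ d) 0) != letter (~~ d)) || (label (edge d 1) != letter d)
}.

Definition coding label : word k.+1 := fun i => label (p i).

Definition obstructed label b : Prop :=
  [/\ 0 < b, 2 * b <= n, (p (n - 2 * b) < p n) != (p (n - b) < p n)
    & agree b (wdrop (n - 2 * b) (coding label))
              (wdrop (n - b) (coding label))].

Definition realizes s : Prop :=
  forall d i j, i <= n -> j <= n -> sltn d (p i) (p j) ->
  wlt d (wdrop i s) (wdrop j s).

Section Necessity.

Variables (s : word k.+1) (label : nat -> 'I_k.+1).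
Hypothesis s_real : realizes s.
Hypothesis label_value : forall i, i <= n -> label (p i) = s i.

Lemma realizes_reflect d i j :
  i <= n -> j <= n -> wlt d (wdrop i s) (wdrop j s) -> sltn d (p i) (p j).
Proof.
move=> i_n j_n lt; have [eij|ne] := eqVneq i j.
  by subst j; case: (wlt_neq lt).
apply: contraPT lt; rewrite sltnNC ?value_eq // => /s_real gt.
by apply: wlt_asym; apply: gt.
Qed.

Lemma realizes_label_mono u v : u <= v -> v <= n -> label u <= label v.
Proof.
rewrite leq_eqVlt => /predU1P[->//|uv] vn.
have [i i_n Ei] := value_surj pi (ltnW (leq_trans uv vn)).
have [j j_n Ej] := value_surj pi vn; subst u v.
rewrite !label_value // leqNgt; apply/negP => lt_ji.
apply: (wlt_asym (@s_real false i j i_n j_n uv)).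
by apply: wlt_head; rewrite /wdrop !addn0.
Qed.

Lemma wcat_suffix l :
  l <= n -> wcat l (wdrop (n - l) s) (wdrop n s) =1 wdrop (n - l) s.
Proof.
move=> l_n m; rewrite -[RHS](wcat_wdrop l) /wcat; case: ltnP => // _.
by rewrite /wdrop addnA subnK.
Qed.

Lemma suffix_not_extreme d l : 0 < l <= n -> p n = edge d 0 ->
  ~ wpower l (wdrop (n - l) s) =1 extreme_word sigma d.
Proof.
move=> /andP[l_gt0 l_n] last_n ext.
have lt : sltn d (p n) (p (n - l)) by apply: value_edge_slt; lia.
have := s_real (leqnn n) (leq_subr l n) lt.
by move/(eq_wltr (fsym (wcat_suffix l_n))); apply: not_wlt_wcat_extreme.
Qed.

Lemma realizes_compatible : compatible label.
Proof.
split; first exact: realizes_label_mono.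
- move=> d i j i_n j_n; rewrite !label_value; try exact: ltnW.
  move=> eq_s lt; apply: realizes_reflect => //.
  have := s_real (ltnW i_n) (ltnW j_n) lt.
  rewrite wlt_shift /wdrop ?addn0 //; apply: eq_wlt => m.
    by rewrite /shift /= addSnnS.
  by rewrite /shift /= addSnnS.
- move=> d n_gt0 pos last_n prev_n; apply/eqP => lab.
  apply: (@suffix_not_extreme d 1) => // m.
  rewrite extreme_word_const // -lab -prev_n label_value ?leq_pred //.
  by rewrite /wpower /wdrop modn1 addn0 subn1.
- move=> d n_gt1 neg_d neg_nd last_n prev_n prev2_n.
  rewrite -negb_and; apply/andP => -[/eqP lab_nd /eqP lab_d].
  apply: (@suffix_not_extreme d 2) => // m.
  rewrite extreme_word_alternating // /wpower /wdrop modn2; case: (odd m).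
    by rewrite addbT -lab_nd -prev_n label_value; [congr s; lia|lia].
  by rewrite addbF -lab_d -prev2_n label_value; [congr s; lia|lia].
Qed.

(* The last [2 b] letters before position [n] form the square of the last [b]
   letters, so that both have the same powers. *)
Lemma realizes_unobstructed b : ~ obstructed label b.
Proof.
case=> b_gt0 b2n side sq.
have bn : b <= n by lia.
have drop_b : wdrop b (wdrop (n - 2 * b) s) =1 wdrop (n - b) s.
  by move=> m; rewrite /wdrop; congr s; lia.
have eq_pow :
    wpower (2 * b) (wdrop (n - 2 * b) s) =1 wpower b (wdrop (n - b) s).
  move=> m; rewrite wpower_square // => [|i ib]; first exact: drop_b.
  by have := sq i ib; rewrite drop_b /wdrop /coding !label_value //; lia.
have same l d : 0 < l <= n ->
    wlt d (wpower l (wdrop (n - l) s)) (wdrop n s) -> sltn d (p (n - l)) (p n).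
  case/andP=> l_gt0 ln /(wlt_wcat_wpower _ _ _ _ l_gt0).
  move/(eq_wltl (wcat_suffix ln)).
  by apply: realizes_reflect; rewrite ?leq_subr.
have [d lt] := value_side pi (ltac:(lia) : n - b < n).
have := s_real (leq_subr b n) (leqnn n) lt.
move/(eq_wltl (fsym (wcat_suffix bn)))/(wlt_wcat_wpower _ _ _ _ b_gt0).
move/(eq_wltl (fsym eq_pow))/(same (2 * b) d ltac:(lia)) => lt2.
by move: side lt lt2; rewrite /sltn; case: d; lia.
Qed.

End Necessity.

Section Sufficiency.

Variable label : nat -> 'I_k.+1.
Hypothesis label_ok : compatible label.

Lemma label_reflect d u v :
  u <= n -> v <= n -> sltn d (label u) (label v) -> sltn d u v.
Proof.
move=> un vn; case: d; rewrite /sltn; apply: contraTT; rewrite -!leqNgt.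
  by move=> uv; apply: (label_mono label_ok).
by move=> vu; apply: (label_mono label_ok).
Qed.

Lemma edge_preimage d v i :
  i < n -> label (p i) = letter d -> p i.+1 = edge (d (+) neg (letter d)) 0 ->
  v <= n -> v != p n -> ~~ sltn d (p i) v -> p i = v.
Proof.
move=> i_n lab_i next_i vn v_last nlt; apply/eqP; apply: contraNT nlt => ne.
apply: contraT; rewrite sltnNC // => gt.
have [j j_n Ej] := value_surj_last vn v_last; subst v.
have lab_j : label (p j) = letter d.
  apply/eqP; apply: contraTT (sltn_asym gt) => ne_j; rewrite negbK.
  apply: label_reflect; rewrite ?value_le // lab_i.
  by rewrite -sltnNC ?extreme_letterP.
have := next_mono label_ok j_n i_n; rewrite lab_i lab_j => /(_ d erefl gt).
rewrite next_i; move: (value_le pi j.+1); rewrite /sltn /edge.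
by case: (_ (+) _); lia.
Qed.

Lemma edge1_preimage d i : i < n -> p n = edge d 0 -> label (p i) = letter d ->
  p i.+1 = edge (d (+) neg (letter d)) 0 -> p i = edge d 1.
Proof.
move=> i_n last_n lab_i next_i; apply: (edge_preimage i_n lab_i next_i).
- by apply: edge_le; lia.
- by rewrite last_n /edge; case: (d); lia.
- have := value_edge_slt i_n last_n; have := value_le pi i.
  by rewrite last_n /edge /sltn; case: (d); lia.
Qed.

Lemma compatible_not_fixed d : 0 < n -> ~~ neg (letter d) ->
  p n = edge d 0 -> label (p n.-1) != letter d.
Proof.
move=> n_gt0 pos last_n; apply/eqP => lab.
have prev_n : p n.-1 = edge d 1.
  apply: edge1_preimage lab _ => //; first by lia.
  by rewrite prednK // (negbTE pos) addbF.
have := edge_not_fixed label_ok n_gt0 pos last_n prev_n.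
by rewrite -prev_n lab eqxx.
Qed.

Lemma compatible_not_swapped d :
  1 < n -> neg (letter d) -> neg (letter (~~ d)) -> p n = edge d 0 ->
  label (p n.-1) = letter (~~ d) -> label (p n.-2) != letter d.
Proof.
move=> n_gt1 neg_d neg_nd last_n lab1; apply/eqP => lab2.
have prev_n : p n.-1 = edge (~~ d) 0.
  apply: edge_preimage lab1 _ _ _ _.
  - by lia.
  - by rewrite neg_nd addbT negbK prednK // ltnW.
  - exact: edge_le.
  - by rewrite last_n /edge; case: (d) => /=; lia.
  - by have := value_le pi n.-1; rewrite /sltn /edge; case: (d) => /=; lia.
have prev2_n : p n.-2 = edge d 1.
  apply: edge1_preimage lab2 _ => //; first by lia.
  by rewrite neg_d addbT -prev_n; congr p; lia.
have := edge_not_swapped label_ok n_gt1 neg_d neg_nd last_n prev_n prev2_n.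
by rewrite -prev_n -prev2_n lab1 lab2 !eqxx.
Qed.

Local Notation z := (coding label).

Lemma next_slt d i j : i < n -> j < n -> z i = z j ->
  sltn d (p i) (p j) = sltn (d (+) neg (z i)) (p i.+1) (p j.+1).
Proof.
move=> i_n j_n eqz; apply/idP/idP; first exact: (next_mono label_ok).
have [<-|ne] := eqVneq i j; first by rewrite sltnn.
apply: contraTT; rewrite sltnNC ?value_eq ?(ltnW i_n) ?(ltnW j_n) // => gt.
have := next_mono label_ok j_n i_n (esym eqz) gt.
by rewrite -/(z j) -eqz => /sltn_asym.
Qed.

Lemma iter_next_slt d i j l : i + l <= n -> j + l <= n ->
  agree l (wdrop i z) (wdrop j z) ->
  sltn d (p i) (p j) =
  sltn (d (+) parity (wdrop i z) l) (p (i + l)) (p (j + l)).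
Proof.
elim: l => [|l IHl] i_n j_n eqz; first by rewrite parity0 addbF !addn0.
rewrite IHl; try lia; last exact: (agree_leq (leqnSn l)).
by rewrite next_slt ?addnS ?parityS ?addbA //; try lia; apply: eqz.
Qed.

(* The value at the star need not be new: the largest value forced from below
   already makes the extension weakly monotone on every block. *)
Definition star_value : nat :=
  \max_(i < n | (z i == z n) && sltn (neg (z n)) (p i) (p n)) p i.+1.

Definition extension (v : nat) : nat :=
  let i : nat := (pi^-1)%g (inord v) in if i < n then p i.+1 else star_value.

Lemma extension_value i : i < n -> extension (p i) = p i.+1.
Proof. by move=> i_n; rewrite /extension valueK ?i_n // ltnW. Qed.

Lemma extension_last : extension (p n) = star_value.
Proof. by rewrite /extension valueK // ltnn. Qed.

Lemma extension_le v : extension v <= n.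
Proof.
rewrite /extension; case: ifP => _; first exact: value_le.
by apply/bigmax_leqP => i _; apply: value_le.
Qed.

Lemma star_value_mono d i : i < n -> z i = z n ->
  sltn (d (+) neg (z n)) star_value (p i.+1) -> sltn d (p n) (p i).
Proof.
move=> i_n ez; apply: contraTT.
rewrite -sltnNC ?value_neq_last // negbK => lt_i.
have [gE|gE] : neg (z n) = d \/ neg (z n) = ~~ d.
  by case: (d); case: (neg _); auto.
  rewrite gE addbb /sltn -leqNgt; rewrite -{}gE in lt_i.
  apply: (@leq_bigmax_cond _ _ (fun i : 'I_n => p i.+1) (Ordinal i_n)) => /=.
  by rewrite ez eqxx.
rewrite gE addbN addbb /sltn -leqNgt; rewrite -sltnC -{}gE in lt_i.
apply/bigmax_leqP => j /andP[/eqP ez_j lt_j].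
have := sltn_trans lt_j lt_i; rewrite next_slt ?ez_j ?ez // addbb.
exact: ltnW.
Qed.

Lemma extension_mono d u v : u <= n -> v <= n -> label u = label v ->
  sltn (d (+) neg (label u)) (extension u) (extension v) -> sltn d u v.
Proof.
move=> un vn; have [i i_n <-] := value_surj pi un.
have [j j_n <-] := value_surj pi vn.
rewrite -/(z i) -/(z j) => ez.
move: i_n j_n; rewrite (leq_eqVlt i) (leq_eqVlt j).
case/predU1P=> [ein|i_n] /predU1P[ejn|j_n].
- by rewrite ein ejn sltnn.
- by subst i; rewrite extension_last extension_value //; apply: star_value_mono.
- subst j; rewrite extension_last extension_value // ez.
  by rewrite -(sltnC (_ (+) _)) -(sltnC d) -addNb; apply: star_value_mono.
- by rewrite !extension_value // (next_slt d i_n).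
Qed.

Definition itinerary (v : nat) : word k.+1 :=
  fun m => label (iter m extension v).

Lemma shift_itinerary v : shift (itinerary v) =1 itinerary (extension v).
Proof. by move=> m; rewrite /shift /itinerary iterSr. Qed.

Lemma itinerary_mono d u v : u <= n -> v <= n ->
  wlt d (itinerary u) (itinerary v) -> sltn d u v.
Proof.
move=> un vn [j]; elim: j d u v un vn => [|j IHj] d u v un vn lt_uv.
  by case: lt_uv => _; rewrite parity0 addbF; apply: label_reflect.
have eq0 : itinerary u 0 = itinerary v 0 by case: lt_uv => /(_ 0 erefl).
apply: extension_mono (eq0) _ => //; apply: IHj; rewrite ?extension_le //.
move/(wlt_at_shift sigma d j eq0): lt_uv.
by apply: agree_wlt_at; apply/agree_eq1/shift_itinerary.
Qed.

Lemma itinerary_value i : i <= n ->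
  itinerary (p i) =1 wcat (n - i) (wdrop i z) (itinerary (p n)).
Proof.
move=> /subnK; move: (n - i) => l; elim: l i => [|l IHl] i i_n m.
  by rewrite /wcat subn0; move: i_n; rewrite add0n => ->.
case: m => [|m]; first by rewrite /wcat /wdrop addn0.
have i_lt : i < n by lia.
have := shift_itinerary (p i) m; rewrite extension_value // /shift => ->.
by rewrite (IHl i.+1) /wcat /wdrop ?addSnnS //; lia.
Qed.

Let power i : word k.+1 := wpower (n - i) (wdrop i z).

Definition weakly_separates w : Prop :=
  forall d i, i < n -> sltn d (p i) (p n) -> ~ wlt d w (power i).

Definition separates w : Prop :=
  forall d i, i < n -> sltn d (p i) (p n) -> wlt d (power i) w.

Lemma weakly_separating_itinerary : weakly_separates (itinerary (p n)).
Proof.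
move=> d i i_n /sltn_asym/negP nlt /wlt_wcat_wpower_r lt; apply: nlt.
apply: (itinerary_mono (value_le pi n) (value_le pi i)).
by apply: eq_wltr (fsym (itinerary_value (ltnW i_n))) (lt _); lia.
Qed.

Lemma suffix_agree_power g i : g %| n - i -> periodic g (power i) ->
  forall q, q * g <= n - i -> agree (q * g) (wdrop (n - q * g) z) (power i).
Proof.
move=> /dvdnP[r r_i] per_g q le_q m mq.
have -> : power i m = power i ((r - q) * g + m).
  exact: esym (periodicM (r - q) per_g m).
by rewrite /power /wpower modn_small /wdrop mulnBl -r_i; [congr z; lia|lia].
Qed.

Hypothesis label_free : forall b, ~ obstructed label b.

Lemma square_same_side g d : 0 < g -> 2 * g <= n ->
  agree g (wdrop (n - 2 * g) z) (wdrop (n - g) z) ->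
  sltn d (p (n - g)) (p n) -> sltn d (p (n - 2 * g)) (p n).
Proof.
move=> g_gt0 g2n sq lt; apply: contraT => nlt.
case: (label_free (b := g)); split=> //.
have := value_eq pi (leq_subr (2 * g) n) (leqnn n).
by move: lt nlt; rewrite /sltn; case: (d); lia.
Qed.

(* Dropping the last [g] letters shifts the values at the positions [n - j * g],
   preserving or reversing their order according to the parity of the root. *)
Lemma power_root_same_side g i d :
  i < n -> 0 < g -> g %| n - i -> periodic g (power i) ->
  sltn d (p (n - g)) (p n) -> sltn d (p i) (p n).
Proof.
move=> i_n g_gt0 g_i per_g lt_g; have root := suffix_agree_power g_i per_g.
have le_i j : j <= (n - i) %/ g -> j * g <= n - i.
  by move=> jq; rewrite -(divnK g_i) leq_mul2r jq orbT.
have agree_j j :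
    0 < j <= (n - i) %/ g -> agree g (wdrop (n - j * g) z) (power i).
  move=> /andP[j_gt0 jq]; apply: agree_leq (root j (le_i j jq)).
  by rewrite leq_pmull.
have last0 : p n = p (n - 0 * g) by rewrite subn0.
have -> : i = n - (n - i) %/ g * g by rewrite divnK // subKn // ltnW.
rewrite last0; apply: (@sltn_shift_equivariant (fun j => p (n - j * g))
                         ((n - i) %/ g) (parity (power i) g)).
- move=> e a b aq bq; have := le_i _ aq; have := le_i _ bq => le_b le_a.
  rewrite (@iter_next_slt _ (n - a.+1 * g) (n - b.+1 * g) g); try lia.
    rewrite (agree_parity sigma (agree_j a.+1 aq)).
    have shiftE c : c.+1 * g <= n -> n - c.+1 * g + g = n - c * g by lia.
    by rewrite !shiftE ?addbK //; lia.
  by move=> m mg; rewrite !agree_j.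
- by rewrite mul1n subn0.
- move=> q2; rewrite subn0; have := le_i _ q2 => le2.
  apply: square_same_side lt_g => //; first by lia.
  by move=> m mg; rewrite agree_j // -[in RHS](mul1n g) agree_j //; lia.
- by rewrite leqnn divn_gt0 // dvdn_leq //; lia.
Qed.

(* Equal powers have a common root, whose length divides both exponents. *)
Lemma power_same_side d i j : i < n -> j < n -> power i =1 power j ->
  sltn d (p i) (p n) -> sltn d (p j) (p n).
Proof.
move=> i_n j_n eq_ij lt_i; pose g := gcdn (n - i) (n - j).
have g_gt0 : 0 < g by rewrite gcdn_gt0 subn_gt0 i_n.
have per_i : periodic g (power i).
  apply: periodic_gcd; [by rewrite subn_gt0|exact: wpower_periodic|].
  by apply: eq_periodic (fsym eq_ij) _; apply: wpower_periodic.
have per_j := eq_periodic eq_ij per_i.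
have [e lt_g] := value_side pi (ltac:(lia) : n - g < n).
have lt_ei := power_root_same_side i_n g_gt0 (dvdn_gcdl _ _) per_i lt_g.
rewrite (sltn_dir lt_i lt_ei).
exact: power_root_same_side (dvdn_gcdr _ _) per_j lt_g.
Qed.

Lemma power_not_extreme d i : 0 < k -> i < n -> p n = edge d 0 ->
  ~ power i =1 extreme_word sigma d.
Proof.
move=> k_gt0 i_n last_n ext.
have z_ext m : 0 < m <= n - i -> z (n - m) = extreme_word sigma d (n - i - m).
  move=> mn; rewrite -ext /power agree_wpower; last by lia.
  by rewrite /wdrop; congr z; lia.
have ext_per : extreme_word sigma d (n - i) = letter d.
  by rewrite -ext /power /wpower modnn -[RHS](ext 0) /power /wpower mod0n.
have l_gt0 : 0 < n - i by rewrite subn_gt0.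
have [pos|[neg_d neg_nd even]] := extreme_word_recurrent k_gt0 l_gt0 ext_per.
  have n_gt0 : 0 < n by lia.
  have /eqP[] := compatible_not_fixed n_gt0 pos last_n.
  by rewrite -subn1 [LHS](z_ext 1) // extreme_word_const.
have l_gt1 : 1 < n - i by case: (n - i) even l_gt0 => [|[]].
have n_gt1 : 1 < n by lia.
have lab1 : label (p n.-1) = letter (~~ d).
  rewrite -subn1 [LHS](z_ext 1) // extreme_word_alternating //.
  by rewrite oddB // (negbTE even) addbT.
have /eqP[] := compatible_not_swapped n_gt1 neg_d neg_nd last_n lab1.
rewrite -subn2 [LHS](z_ext 2) // extreme_word_alternating //.
by rewrite oddB // (negbTE even) addbF.
Qed.

Lemma weakly_separates_strict w d i : weakly_separates w ->
  i < n -> sltn d (p i) (p n) -> ~ power i =1 w -> wlt d (power i) w.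
Proof.
by move=> weak i_n lt ne; case: (wlt_total sigma d ne) => // /weak[].
Qed.

Section Perturbation.

Variables (d : bool) (i0 : nat).
Hypotheses (i0_n : i0 < n) (lt0 : sltn d (p i0) (p n)).
Hypothesis power_weak : weakly_separates (power i0).

Lemma power_wlt_far_side j :
  j < n -> sltn d (p n) (p j) -> wlt d (power i0) (power j).
Proof.
move=> j_n lt_j; apply/wltC.
apply: weakly_separates_strict; rewrite ?sltnC // => /fsym eq_j.
by have /sltn_asym/negP[] := power_same_side i0_n j_n eq_j lt0.
Qed.

Lemma power_not_greatest : 0 < k -> exists b, wlt d (power i0) b.
Proof.
move=> k_gt0; have [last_n|last_n] := eqVneq (p n) (edge (~~ d) 0).
  exists (extreme_word sigma (~~ d)); apply/wltC/extreme_word_wlt => /fsym.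
  exact: power_not_extreme.
rewrite eq_sym in last_n.
have [j j_n Ej] := value_surj_last (edge_le (~~ d) (leq0n n)) last_n.
exists (power j); apply: power_wlt_far_side => //.
by move: last_n (value_le pi n); rewrite Ej /sltn /edge; case: (d) => /=; lia.
Qed.

Lemma power_perturbation : 0 < k -> exists w, separates w.
Proof.
move=> k_gt0; have [b lt_b] := power_not_greatest k_gt0.
pose far := {i : 'I_n | sltn d (p n) (p i)}.
have [|w lt_w w_far] := periodic_dense (ltac:(lia) : 0 < n - i0)
    (wpower_periodic _ _) lt_b (x := fun a : far => power (val a)).
  by case=> j lt_j; apply: power_wlt_far_side.
exists w => e i i_n lt_i; have [far_i|] := boolP (sltn d (p n) (p i)).
  have -> : e = ~~ d by apply: sltn_dir lt_i _; rewrite sltnC.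
  by apply/wltC; apply: (w_far (exist _ (Ordinal i_n) far_i)).
rewrite -sltnNC ?value_neq_last // negbK => near_i.
rewrite (sltn_dir lt_i near_i).
case: (classic (power i =1 power i0)) => [eq_i|ne_i].
  exact: eq_wltl (fsym eq_i) lt_w.
exact: wlt_trans (weakly_separates_strict power_weak i_n near_i ne_i) lt_w.
Qed.

End Perturbation.

Lemma separating_word : 0 < k -> exists w, separates w.
Proof.
move=> k_gt0; have weak := weakly_separating_itinerary.
set w0 := itinerary _ in weak.
case: (classic (exists2 i, i < n & power i =1 w0)) => [[i0 i0_n eq0]|none].
  have [d lt0] := value_side pi i0_n.
  apply: (power_perturbation i0_n lt0) => // e i i_n.
  by move/(weak _ _ i_n) => nlt /(eq_wltl eq0).
exists w0 => d i i_n lt; apply: weakly_separates_strict => // eq_i.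
by apply: none; exists i.
Qed.

Lemma separates_realizes w : separates w -> realizes (wcat n z w).
Proof.
move=> sep; set s := wcat n z w.
have letter_s i : i < n -> wdrop i s 0 = z i.
  by move=> i_n; rewrite /wdrop addn0 /s agree_wcat.
have lt_last d i : i < n -> sltn d (p i) (p n) -> wlt d (wdrop i s) (wdrop n s).
  move=> i_n lt; apply: (@eq_wlt _ _ _ (wcat (n - i) (wdrop i z) w) _ w).
  - move=> m; rewrite /wdrop /s /wcat ltn_subRL ?subnBA ?(ltnW i_n) //.
    by rewrite [m + i]addnC.
  - by move=> m; rewrite wdrop_wcat.
  - by apply/wlt_wcat_wpower; [lia|apply: sep].
suff lt_upto l d i j : i <= n -> j <= n -> n <= maxn i j + l ->
    sltn d (p i) (p j) -> wlt d (wdrop i s) (wdrop j s).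
  by move=> d i j i_n j_n; apply: (lt_upto n) => //; lia.
elim: l d i j => [|l IHl] d i j.
all: rewrite (leq_eqVlt i) (leq_eqVlt j).
all: move=> /predU1P[->|i_n] /predU1P[->|j_n] max_ij lt.
all: try by rewrite sltnn in lt.
all: try exact: lt_last.
all: try by apply/wltC; apply: lt_last; rewrite // sltnC.
  by lia.
have [eqz|nez] := eqVneq (z i) (z j); last first.
  apply: wlt_head; rewrite !letter_s //.
  apply: contraTT lt; rewrite sltnNC // => /label_reflect gt.
  by rewrite sltn_asym // gt ?value_le.
have eq0 : wdrop i s 0 = wdrop j s 0 by rewrite !letter_s.
apply/(wlt_shift sigma d eq0); rewrite letter_s //.
have := IHl (d (+) neg (z i)) i.+1 j.+1 i_n j_n ltac:(lia).
rewrite -next_slt // => /(_ lt).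
by apply: eq_wlt => m; rewrite /wdrop /shift addSnnS.
Qed.

End Sufficiency.
End Realization.

Section StarWords.

Implicit Types (tau u : seq (option nat)).

Lemma starts_withP tau u : starts_with tau u <->
  size u <= size tau /\ forall i, i < size u -> nth None tau i = nth None u i.
Proof.
rewrite /starts_with; split=> [E|[le E]].
  split=> [|i iu]; last by rewrite -E nth_take.
  by rewrite -E size_take_min geq_minr.
have sz : size (take (size u) tau) = size u by rewrite size_takel.
apply: (@eq_from_nth _ None) => // i; rewrite sz => iu.
by rewrite nth_take ?E.
Qed.

Lemma ends_with_rev tau u : ends_with tau (rev u) <-> starts_with (rev tau) u.
Proof.
rewrite /ends_with /starts_with size_rev take_rev.
split=> [[_ ->]|/(canRL revK) E]; first exact: revK.
by split=> //; move/(congr1 size): E; rewrite size_drop size_rev; lia.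
Qed.

Lemma edge_factorP n d tau u : size tau = n.+1 ->
  (if d then ends_with tau (rev u) else starts_with tau u) <->
  size u <= n.+1 /\
  forall i, i < size u -> nth None tau (edge n d i) = nth None u i.
Proof.
move=> sz; case: d; last by rewrite starts_withP sz.
rewrite ends_with_rev starts_withP size_rev sz.
by split=> -[le E]; split=> // i iu; rewrite -E // nth_rev sz ?subSS //; lia.
Qed.

Lemma edge_letterP n d tau a : size tau = n.+1 ->
  (if d then ends_with tau [:: a] else starts_with tau [:: a]) <->
  nth None tau (edge n d 0) = a.
Proof.
move=> sz; apply: iff_trans (edge_factorP d [:: a] sz) _.
by split=> [[_ /(_ 0)->]|E] //; split=> // -[].
Qed.

Lemma edge_pairP n d tau a b : size tau = n.+1 ->
  (if d then ends_with tau [:: b; a] else starts_with tau [:: a; b]) <->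
  [/\ 0 < n, nth None tau (edge n d 0) = a & nth None tau (edge n d 1) = b].
Proof.
move=> sz; apply: iff_trans (edge_factorP d [:: a; b] sz) _.
split=> [[n_gt0 E]|[n_gt0 E0 E1]]; first by split; [|exact: (E 0)|exact: (E 1)].
by split=> // -[|[]].
Qed.

Lemma pairwise_pmap_id (T : eqType) (r : rel T) (w : seq (option T)) :
  pairwise r (pmap id w) <->
  forall i j x y, i < j -> nth None w i = Some x -> nth None w j = Some y ->
    r x y.
Proof.
elim: w => [|o w IH] /=.
  by split=> // _ i j x y _; rewrite nth_nil.
have tailP : (forall i j x y, i < j -> nth None (o :: w) i = Some x ->
    nth None (o :: w) j = Some y -> r x y) -> pairwise r (pmap id w).
  by move=> r_w; apply/IH => i j x y ij; apply: (r_w i.+1 j.+1).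
case: o tailP => [a|] tailP /=; last first.
  by split=> [/IH r_w|/tailP//]; case=> [|i] [|j] x y //=; apply: (r_w i j).
split=> [/andP[/allP ra /IH r_w]|r_w].
  case=> [|i] [|j] x y //=; last exact: (r_w i j).
  move=> _ [<-] Ey; apply: ra; rewrite mem_pmap map_id -Ey mem_nth //.
  by case: ltnP => // le; rewrite nth_default in Ey.
rewrite tailP // andbT; apply/allP => y; rewrite mem_pmap map_id => y_w.
by apply: (r_w 0 (index (Some y) w).+1) => //=; apply: nth_index.
Qed.

Lemma sorted_block (r : rel nat) tau a b : transitive r ->
  sorted r (block tau a b) <->
  forall i j x y, a <= i < j -> j < b -> nth None tau i = Some x ->
    nth None tau j = Some y -> r x y.
Proof.
move=> r_trans; rewrite sorted_pairwise // pairwise_pmap_id.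
split=> r_tau i j x y.
  move=> aij jb Ex Ey; apply: (r_tau (i - a) (j - a)); first by lia.
    by rewrite nth_take ?nth_drop ?subnKC //; lia.
  by rewrite nth_take ?nth_drop ?subnKC //; lia.
move=> ij Ex Ey.
have jb : j < b - a.
  rewrite ltnNge; apply/negP => le; move: Ey.
  by rewrite nth_default // size_take_min (leq_trans (geq_minl _ _)).
move: Ex Ey; rewrite !nth_take ?nth_drop; try lia.
by apply: r_tau; lia.
Qed.

Lemma is_rho_312_or_132 a b c : a != c -> b != c ->
  is_rho (fun u v : nat => u < v) [tuple a; b; c] [:: 3; 1; 2] \/
  is_rho (fun u v : nat => u < v) [tuple a; b; c] [:: 1; 3; 2] <->
  (a < c) != (b < c).
Proof.
move=> ac bc; split.
  by case=> -[_ rho]; have := rho (inord 0) (inord 2);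
     have := rho (inord 1) (inord 2); rewrite !(tnth_nth 0) !inordK //=; lia.
by case: (ltnP a c) => [lt|le] side; [right|left]; split=> // -[[|[|[|//]]] i3];
   case=> -[|[|[|//]]] j3; rewrite !(tnth_nth 0) /=; split=> //; lia.
Qed.

End StarWords.

Section Breakpoints.

Variables k n : nat.
Implicit Types (e : seq nat) (t : 'I_k.+1) (label : nat -> 'I_k.+1).

Record breakpoints e : Prop := Breakpoints {
  bp_size : size e = k.+2;
  bp_first : nth 0 e 0 = 0;
  bp_last : nth 0 e k.+1 = n.+1;
  bp_sorted : sorted leq e
}.

(* Values are counted from 0, so the block [t] holds the values [v] with
   [e_t <= v < e_(t+1)]. *)
Definition block_label e label : Prop :=
  forall v, v <= n -> nth 0 e (label v) <= v < nth 0 e (label v).+1.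

Lemma bp_leq e i j :
  breakpoints e -> i <= j -> j <= k.+1 -> nth 0 e i <= nth 0 e j.
Proof.
case=> sz _ _ srt ij jk.
by apply: (sorted_leq_nth leq_trans leqnn) => //; rewrite inE sz; lia.
Qed.

Lemma block_labelE e label v t :
  breakpoints e -> block_label e label -> v <= n ->
  (nth 0 e t <= v < nth 0 e t.+1) = (label v == t).
Proof.
move=> bp lab vn; apply/idP/eqP => [in_t|<-]; last exact: lab.
apply: val_inj.
have [lt|gt|//] := ltngtP (label v) t.
  by have := bp_leq bp lt (ltnW (ltn_ord t)); have := lab v vn; lia.
by have := bp_leq bp gt (ltnW (ltn_ord (label v))); have := lab v vn; lia.
Qed.

Lemma block_label_mono e label u v : breakpoints e -> block_label e label ->
  u <= v -> v <= n -> label u <= label v.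
Proof.
move=> bp lab uv vn; rewrite leqNgt; apply/negP => lt.
have := lab v vn; have := lab u (leq_trans uv vn).
by have := bp_leq bp lt (ltnW (ltn_ord _)); lia.
Qed.

Lemma block_label_exists e : breakpoints e -> exists label, block_label e label.
Proof.
move=> bp; pose in_block v t := nth 0 e t <= v < nth 0 e t.+1.
exists (fun v => odflt ord0 [pick t : 'I_k.+1 | in_block v t]) => v vn.
case: pickP => [//|none].
have above : exists m, v < nth 0 e m by exists k.+1; rewrite bp_last.
have [[|m] lt_v min_m] := ex_minnP above; first by rewrite bp_first in lt_v.
have mk : m < k.+1 by apply: min_m; rewrite bp_last.
have := none (Ordinal mk); rewrite /in_block lt_v andbT leqNgt.
by move/negbFE/min_m; rewrite ltnn.
Qed.

Lemma card_ord_lt m : m <= n.+1 -> #|[set i : 'I_n.+1 | i < m]| = m.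
Proof.
move=> mn; rewrite -sum1dep_card -(big_ord_widen _ (fun _ => 1) mn).
by rewrite sum1_card card_ord.
Qed.

Lemma mono_block_label label :
  (forall u v, u <= v -> v <= n -> label u <= label v) ->
  exists2 e, breakpoints e & block_label e label.
Proof.
move=> mono; pose below j := [set v : 'I_n.+1 | label v < j].
pose e := mkseq (fun j => #|below j|) k.+2.
have nthE j : j <= k.+1 -> nth 0 e j = #|below j|.
  by move=> jk; rewrite nth_mkseq.
exists e.
  split; rewrite ?size_mkseq ?nthE //.
  - by apply: eq_card0 => v; rewrite inE.
  - by rewrite -[RHS](card_ord n.+1); apply: eq_card => v; rewrite !inE ltn_ord.
  - apply/(sortedP 0) => j; rewrite size_mkseq => jk.
    rewrite !nthE //; last exact: ltnW.
    by apply/subset_leq_card/subsetP => v; rewrite !inE; apply: leqW.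
move=> v vn; have lab_k := ltn_ord (label v).
rewrite !nthE //; last exact: ltnW.
apply/andP; split.
  rewrite -[leqRHS](card_ord_lt (leqW vn)); apply/subset_leq_card/subsetP => u.
  by rewrite !inE !ltnNge; apply: contra => /mono; apply; apply: leq_ord.
rewrite -[leqLHS](card_ord_lt (m := v.+1)) //.
apply/subset_leq_card/subsetP => u; rewrite !inE !ltnS => uv; exact: mono.
Qed.

End Breakpoints.

Section Translation.

Variables (k : nat) (sigma : signature k.+1) (n : nat) (pi : 'S_n.+1).

Local Notation p := (value pi).
Local Notation tau := (hat_star pi).
Local Notation edge := (edge n).
Local Notation letter := (extreme_letter k).
Local Notation neg := (neg sigma).
Implicit Types (d : bool) (e : seq nat) (label : nat -> 'I_k.+1).

Lemma nth_one_line (q : 'S_n.+1) i :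
  i <= n -> nth 0 (one_line q) i = (value q i).+1.
Proof.
move=> i_n; rewrite (nth_map ord0) ?size_enum_ord //.
by congr (q _).+1; apply: val_inj; rewrite /= nth_enum_ord ?inordK.
Qed.

Lemma size_hat_star : size tau = n.+1.
Proof. by rewrite 2!size_map size_enum_ord. Qed.

Lemma ordS_inord i : i < n -> ordS (inord i : 'I_n.+1) = inord i.+1.
Proof.
by move=> i_n; apply: val_inj; rewrite /= !inordK ?modn_small // ltnW.
Qed.

Lemma ordS_inord_max : ordS (inord n : 'I_n.+1) = inord 0.
Proof. by apply: val_inj; rewrite /= !inordK // modnn. Qed.

Lemma hatE x : hat pi (pi x) = pi (ordS x).
Proof. by rewrite permE permK. Qed.

Lemma nth_hat_star i : i <= n ->
  nth None tau (p i) = if i < n then Some (p i.+1).+1 else None.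
Proof.
move=> i_n; rewrite (nth_map 0); last by rewrite size_map size_enum_ord ltn_ord.
rewrite nth_one_line ?value_le // /entry nth_one_line //.
have -> : value (hat pi) (p i) = pi (ordS (inord i)).
  by rewrite /value inord_val hatE.
rewrite eqSS; case: ltnP => [lt|ge].
  by rewrite ordS_inord // -/(p i.+1) value_eq.
by have -> : i = n; [lia|rewrite ordS_inord_max eqxx].
Qed.

Lemma nth_hat_star_None v : v <= n -> nth None tau v = None <-> p n = v.
Proof.
move=> vn; have [i i_n <-] := value_surj pi vn; rewrite nth_hat_star //.
split=> [|/eqP]; first by case: ltnP => // ni _; congr p; lia.
by rewrite value_eq // eq_sym => /eqP->; rewrite ltnn.
Qed.

Lemma nth_hat_star_next v i x : v <= n -> i < n -> p i.+1 = x ->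
  nth None tau v = Some x.+1 <-> p i = v.
Proof.
move=> vn i_n <-; have [j j_n <-] := value_surj pi vn; rewrite nth_hat_star //.
split=> [|/eqP]; last first.
  by rewrite value_eq // ?(ltnW i_n) // => /eqP<-; rewrite i_n.
case: ltnP => // j_lt [/eqP]; rewrite value_eq // => /eqP eS; congr p; lia.
Qed.

(* The hypothesis on the ends of the word in (b) or in (c). *)
Lemma hat_star_fixedP d :
  (if d then ends_with tau [:: Some (size tau); None]
   else starts_with tau [:: None; Some 1]) <->
  [/\ 0 < n, p n = edge d 0 & p n.-1 = edge d 1].
Proof.
have fixedE : 0 < n -> p n = edge d 0 ->
    nth None tau (edge d 1) = Some (edge d 0).+1 <-> p n.-1 = edge d 1.
  by move=> n_gt0 last_n; apply: nth_hat_star_next; rewrite ?edge_le ?prednK.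
apply: (@iff_trans _ [/\ 0 < n, nth None tau (edge d 0) = None
                      & nth None tau (edge d 1) = Some (edge d 0).+1]).
  rewrite -edge_pairP ?size_hat_star //.
  by case: d {fixedE}; rewrite /edge ?subn0.
split=> -[n_gt0 last_n prev_n]; split=> //.
- by apply/nth_hat_star_None; rewrite ?edge_le.
- by apply/fixedE => //; apply/nth_hat_star_None; rewrite ?edge_le.
- by apply/nth_hat_star_None; rewrite ?edge_le.
- by apply/fixedE.
Qed.

(* The hypothesis on the ends of the word in (e) or in (d). *)
Lemma hat_star_swappedP d :
  (if d
   then starts_with tau [:: Some (size tau)] /\ ends_with tau [:: Some 1; None]
   else ends_with tau [:: Some 1] /\ starts_with tau [:: None; Some (size tau)])
  <->
  [/\ 1 < n, p n = edge d 0, p n.-1 = edge (~~ d) 0 & p n.-2 = edge d 1].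
Proof.
apply: (@iff_trans _ (nth None tau (edge (~~ d) 0) = Some (edge d 0).+1 /\
    [/\ 0 < n, nth None tau (edge d 0) = None
     & nth None tau (edge d 1) = Some (edge (~~ d) 0).+1])).
  rewrite -(edge_letterP (~~ d)) ?size_hat_star // -edge_pairP ?size_hat_star //.
  by case: d; rewrite /edge ?subn0.
have lastE := nth_hat_star_None (edge_le d (leq0n n)).
have prevE : 0 < n -> p n = edge d 0 ->
    nth None tau (edge (~~ d) 0) = Some (edge d 0).+1 <->
    p n.-1 = edge (~~ d) 0.
  by move=> n_gt0 last_n; apply: nth_hat_star_next; rewrite ?edge_le ?prednK.
have prev2E : 1 < n -> p n.-1 = edge (~~ d) 0 ->
    nth None tau (edge d 1) = Some (edge (~~ d) 0).+1 <-> p n.-2 = edge d 1.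
  move=> n_gt1 prev_n; apply: nth_hat_star_next.
  - by rewrite edge_le // ltnW.
  - by lia.
  - by rewrite -prev_n; congr p; lia.
split=> [[prev_n [n_gt0 /lastE last_n prev2_n]]|[n_gt1 last_n prev_n prev2_n]].
  have n_gt1 : 1 < n.
    rewrite ltn_neqAle n_gt0 andbT; apply/eqP => n_eq1; move: prev_n prev2_n.
    have -> : edge d 1 = edge (~~ d) 0 by rewrite /edge; case: (d) => /=; lia.
    by move=> -> []; rewrite /edge; case: (d) => /=; lia.
  move/(prevE n_gt0 last_n): prev_n => prev_n; split=> //.
  exact/(prev2E n_gt1 prev_n).
have n_gt0 := ltnW n_gt1; split; first exact/(prevE n_gt0 last_n).
by split=> //; [apply/lastE|apply/(prev2E n_gt1 prev_n)].
Qed.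

Section Blocks.

Variables (e : seq nat) (label : nat -> 'I_k.+1).
Hypotheses (bp : breakpoints k n e) (lab : block_label n e label).

Lemma label_edge d v : v <= n ->
  (label v == letter d) = (if d then nth 0 e k <= v else v < nth 0 e 1).
Proof.
move=> vn; rewrite -(block_labelE _ bp lab vn); case: d => /=.
  by rewrite (bp_last bp) ltnS vn andbT.
by rewrite (bp_first bp).
Qed.

Lemma nth_signature d : nth true sigma (letter d) = ~~ neg (letter d).
Proof. by rewrite /neg negbK (tnth_nth true). Qed.

Lemma signature_orderE (t : 'I_k.+1) :
  (if tnth sigma t then ltn else gtn) =2 sltn (neg t).
Proof. by move=> x y; rewrite /neg; case: (tnth sigma t). Qed.

Lemma signature_order_trans (t : 'I_k.+1) :
  transitive (if tnth sigma t then ltn else gtn).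
Proof. by move=> y x z; rewrite !signature_orderE; apply: sltn_trans. Qed.

Lemma next_monoP :
  (forall t : 'I_k.+1, sorted (if tnth sigma t then ltn else gtn)
     (block tau (nth 0 e t) (nth 0 e t.+1))) <->
  (forall d i j, i < n -> j < n -> label (p i) = label (p j) ->
    sltn d (p i) (p j) -> sltn (d (+) neg (label (p i))) (p i.+1) (p j.+1)).
Proof.
have in_block i (t : 'I_k.+1) :
    (nth 0 e t <= p i < nth 0 e t.+1) = (label (p i) == t).
  by rewrite (block_labelE _ bp lab) ?value_le.
split=> [srt d i j i_n j_n eq_lab lt|next t].
  have inc a b : a < n -> b < n -> label (p a) = label (p b) -> p a < p b ->
      sltn (neg (label (p a))) (p a.+1) (p b.+1).
    move=> a_n b_n eq_ab ltp; have := in_block a (label (p a)).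
    have := in_block b (label (p a)); rewrite -eq_ab eqxx => in_b in_a.
    have := srt (label (p a)).
    move/(sorted_block tau _ _ (@signature_order_trans _)).
    move/(_ (p a) (p b) (p a.+1).+1 (p b.+1).+1); rewrite signature_orderE.
    rewrite !nth_hat_star ?(ltnW a_n) ?(ltnW b_n) // a_n b_n => inc_ab.
    by apply: inc_ab => //; lia.
  case: d lt => lt; last exact: inc.
  by rewrite addTb sltnC eq_lab; apply: inc.
apply/(sorted_block _ _ _ (@signature_order_trans t)) => u v x y uv v_t.
have vn : v <= n.
  by have := bp_leq bp (ltn_ord t) (leqnn _); rewrite (bp_last bp); lia.
have [i i_n Ei] := value_surj pi (ltac:(lia) : u <= n).
have [j j_n Ej] := value_surj pi vn; subst u v; rewrite !nth_hat_star //.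
case: ltnP => // i_lt [<-]; case: ltnP => // j_lt [<-].
have lab_i : label (p i) = t by apply/eqP; rewrite -in_block; lia.
have lab_j : label (p j) = t by apply/eqP; rewrite -in_block; lia.
have := next false i j i_lt j_lt; rewrite lab_i lab_j signature_orderE.
by move/(_ erefl ltac:(rewrite /sltn; lia)).
Qed.

Lemma segmentation_compatible :
  segmentation sigma tau e -> compatible sigma pi label.
Proof.
case=> _ _ _ _ /next_monoP next.
rewrite /= size_hat_star => seg_b seg_c seg_d seg_e.
split=> // [u v||].
- exact: (block_label_mono bp lab).
- move=> d n_gt0 pos last_n prev_n.
  have /hat_star_fixedP := And3 n_gt0 last_n prev_n.
  rewrite label_edge ?edge_le //; rewrite -nth_signature in pos.
  case: d pos {last_n prev_n} => /= pos; rewrite ?size_hat_star.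
    by move/(seg_c pos); lia.
  by move/(seg_b pos); lia.
- move=> d n_gt1 neg_d neg_nd last_n prev_n prev2_n.
  have /hat_star_swappedP := And4 n_gt1 last_n prev_n prev2_n.
  move=> ends; rewrite !label_edge ?edge_le ?(ltnW n_gt1) //.
  have sig0 := nth_signature false; have sigk := nth_signature true.
  case: d neg_d neg_nd ends {last_n prev_n prev2_n} => /= neg_d neg_nd;
    rewrite ?neg_d ?neg_nd ?size_hat_star /= in sig0 sigk *; case=> end1 end2.
    by have := seg_d sig0 sigk end1 end2; lia.
  by have := seg_e sig0 sigk end1 end2; lia.
Qed.

Lemma compatible_segmentation :
  compatible sigma pi label -> segmentation sigma tau e.
Proof.
case=> _ next fixed swapped.
have negI d : nth true sigma (letter d) = false -> neg (letter d).
  by rewrite nth_signature => /negbFE.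
case: (bp) => sz first last srt; split=> //; rewrite ?size_hat_star //=.
- exact/next_monoP.
- move=> pos /(hat_star_fixedP false)[n_gt0 last_n prev_n].
  have := fixed false n_gt0; rewrite -nth_signature => /(_ pos last_n prev_n).
  by rewrite label_edge //= -leqNgt.
- move=> pos ends; have := (hat_star_fixedP true).1; rewrite size_hat_star.
  case/(_ ends) => n_gt0 last_n prev_n.
  have := fixed true n_gt0; rewrite -nth_signature => /(_ pos last_n prev_n).
  by rewrite label_edge ?edge_le //=; lia.
- move=> sig0 sigk start_n end_1; have := (hat_star_swappedP true).1.
  rewrite size_hat_star; case/(_ (conj start_n end_1)) => n_gt1 last_n prev_n.
  move/(swapped true n_gt1 (negI true sigk) (negI false sig0) last_n prev_n).
  by rewrite !label_edge ?edge_le ?(ltnW n_gt1) //=; lia.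
- move=> sig0 sigk end_1 start_n; have := (hat_star_swappedP false).1.
  rewrite size_hat_star; case/(_ (conj end_1 start_n)) => n_gt1 last_n prev_n.
  move/(swapped false n_gt1 (negI false sig0) (negI true sigk) last_n prev_n).
  rewrite !label_edge ?edge_le ?(ltnW n_gt1) //=.
  by have := bp_leq bp (leqnSn k) (leqnn _); rewrite last; lia.
Qed.

Lemma same_blockP i j :
  (forall t, t < k.+1 ->
    nth 0 e t < (p i).+1 <= nth 0 e t.+1 <->
    nth 0 e t < (p j).+1 <= nth 0 e t.+1) <->
  label (p i) = label (p j).
Proof.
have in_block m t : t < k.+1 ->
    (nth 0 e t < (p m).+1 <= nth 0 e t.+1) = (label (p m) == t :> nat).
  move=> tk; rewrite ltnS.
  exact: (block_labelE (Ordinal tk) bp lab (value_le pi m)).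
split=> [same|eq_lab t tk]; last by rewrite !in_block // eq_lab.
have := same (label (p j)) (ltn_ord _); rewrite !in_block // eqxx.
by case=> _ /(_ erefl)/eqP/val_inj.
Qed.

(* The letters [i] of the two factors compared by [obstructed] are those that
   [dagger_obstruction] compares for the index [b - i]. *)
Lemma dagger_obstructionE b :
  dagger_obstruction k.+1 pi e b <-> obstructed pi label b.
Proof.
have entryE m : m <= n -> entry (one_line pi) (n.+1 - m) = (p (n - m)).+1.
  by move=> mn; rewrite subSn // /entry nth_one_line ?leq_subr.
have entry_last : entry (one_line pi) n.+1 = (p n).+1.
  by rewrite /entry nth_one_line.
have side_neq m : 0 < m <= n -> (p (n - m)).+1 != (p n).+1.
  by move=> mn; rewrite eqSS value_eq ?leq_subr //; lia.
split=> -[b_gt0 bn side same]; have {}bn : 2 * b <= n by lia.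
  split=> // [|i ib].
    move: side; rewrite entry_last !entryE; try lia.
    by rewrite is_rho_312_or_132 ?side_neq //; lia.
  rewrite /wdrop /coding.
  have -> : n - 2 * b + i = n - (b + (b - i)) by lia.
  have -> : n - b + i = n - (b - i) by lia.
  apply/same_blockP => t tk.
  by have := same (b - i) t ltac:(lia) tk; rewrite -!subnDA !entryE; lia.
split=> //; first by lia.
  rewrite entry_last !entryE; try lia.
  by rewrite is_rho_312_or_132 ?side_neq //; lia.
move=> i t ib tk; rewrite -!subnDA !entryE; try lia.
move: t tk; apply/same_blockP; have := same (b - i) ltac:(lia).
rewrite /wdrop /coding.
have -> : n - 2 * b + (b - i) = n - (b + i) by lia.
by have -> : n - b + (b - i) = n - i by lia.
Qed.

End Blocks.

Lemma segmentation_breakpoints e :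
  segmentation sigma tau e -> breakpoints k n e.
Proof.
by case=> sz first last srt *; split=> //; rewrite last size_hat_star.
Qed.

Lemma hat_full_cycle : is_full_cycle (hat pi).
Proof.
have orbit0 : porbit (hat pi) (pi (inord 0)) = setT.
  apply/setP => y; rewrite inE; apply/porbitP; exists ((pi^-1)%g y).
  have iterE m : m <= n -> (hat pi ^+ m)%g (pi (inord 0)) = pi (inord m).
    elim: m => [|m IHm] mn; first by rewrite expg0 perm1.
    by rewrite expgSr permM IHm ?(ltnW mn) // hatE ordS_inord.
  by rewrite iterE ?inord_val ?permKV // leq_ord.
apply/setP => X; rewrite inE; apply/imsetP/eqP => [[x _ ->]|->].
  by rewrite -orbit0; apply/eqP; rewrite eq_porbit_mem orbit0 inE.
by exists (pi (inord 0)).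
Qed.

Lemma hat_star_in_C_star : in_C_star n.+1 tau.
Proof.
exists (hat pi), (entry (one_line pi) 1).
split=> //; first exact: hat_full_cycle.
rewrite /entry nth_one_line //; apply/mapP.
by exists (pi (inord n)); rewrite ?mem_enum // hatE ordS_inord_max.
Qed.

Lemma perm_eq_one_line : perm_eq (one_line pi) (iota 1 n.+1).
Proof.
apply: uniq_perm; rewrite ?iota_uniq //.
  by rewrite map_inj_uniq ?enum_uniq // => x y [/val_inj/perm_inj].
move=> v; rewrite mem_iota add1n; apply/mapP/idP => [[i _ ->]|].
  by rewrite !ltnS leq_ord.
case: v => // v; rewrite ltnS => vn.
by exists ((pi^-1)%g (inord v)); rewrite ?mem_enum // permKV inordK.
Qed.

Lemma is_Pat_realizes s : is_Pat sigma s pi <-> realizes sigma pi s.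
Proof.
have nthE (i : 'I_n.+1) : nth 0 (one_line pi) i = (p i).+1.
  by rewrite nth_one_line ?leq_ord.
have precP (i j : 'I_n.+1) :
    prec sigma (tnth [tuple iter i (@shift k.+1) s | i < n.+1] i)
      (tnth [tuple iter i (@shift k.+1) s | i < n.+1] j) <->
    wlt sigma false (wdrop i s) (wdrop j s).
  rewrite !tnth_mktuple precE.
  by split; apply: eq_wlt => m; rewrite ?iter_shift.
split=> [[_ [_ pat]] d i j i_n j_n|real].
  have lt_prec a b : a <= n -> b <= n -> p a < p b ->
      wlt sigma false (wdrop a s) (wdrop b s).
    move=> an bn lt; have [_] := pat (inord a) (inord b).
    by rewrite !nthE ltnS !inordK // => /(_ lt) /precP; rewrite !inordK.
  by case: d => lt; [apply/wltC|]; apply: lt_prec.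
split=> [i j ij eq_ij|].
  have [d lt] : exists d, sltn d (p i) (p j).
    by apply: sltn_total; rewrite value_eq ?leq_ord.
  apply: (wlt_neq (real d i j (leq_ord i) (leq_ord j) lt)) => m.
  by rewrite -!iter_shift eq_ij.
split=> [|i j]; first exact: perm_eq_one_line.
rewrite !nthE ltnS; split=> [/precP|].
  exact: (realizes_reflect (d := false) real (leq_ord i) (leq_ord j)).
by move=> lt; apply/precP; apply: (real false) lt; apply: leq_ord.
Qed.

Lemma realizes_segmentation s : realizes sigma pi s ->
  exists2 e, segmentation sigma tau e &
    ~ exists b, dagger_obstruction k.+1 pi e b.
Proof.
move=> real; pose label v := s ((pi^-1)%g (inord v)).
have label_value i : i <= n -> label (p i) = s i.
  by move=> i_n; rewrite /label valueK.
have [e bp lab] := mono_block_label (realizes_label_mono real label_value).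
exists e.
  exact: compatible_segmentation (realizes_compatible real label_value).
case=> b /(dagger_obstructionE bp lab).
exact: (realizes_unobstructed real label_value).
Qed.

Lemma segmentation_realizes e : 0 < k -> segmentation sigma tau e ->
  ~ (exists b, dagger_obstruction k.+1 pi e b) -> exists s, realizes sigma pi s.
Proof.
move=> k_gt0 seg free; have bp := segmentation_breakpoints seg.
have [label lab] := block_label_exists bp.
have ok := segmentation_compatible bp lab seg.
have unobstructed b : ~ obstructed pi label b.
  by move/(dagger_obstructionE bp lab) => obs; apply: free; exists b.
have [w sep] := separating_word ok unobstructed k_gt0.
by eexists; apply: separates_realizes sep.
Qed.

End Translation.

Theorem theorem2p1 (k : nat) (sigma : signature k) (n : nat) (pi : 'S_n) :
  2 <= k -> 1 <= n ->
  allowed sigma pi <->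
  in_C_sigma_star sigma (hat_star pi) /\ dagger sigma pi.
Proof.
case: k sigma => [//|k] sigma k_gt0; case: n pi => [//|n] pi _.
split=> [[s /is_Pat_realizes real]|[_ [e [seg free]]]].
  have [e seg free] := realizes_segmentation real; split; last by exists e.
  by split; [exists n.+1; apply: hat_star_in_C_star|exists e].
have [s real] := segmentation_realizes k_gt0 seg free.
by exists s; apply/is_Pat_realizes.
Qed.
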